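(* Let $\mathcal{H}$ be a complex Hilbert space, let $T,S\in\mathcal{B}(\mathcal{H})$, let $q\in(0,1]$, and let $n$ be a positive integer. Let $\mathbb{P}=[P_{ij}]_{i,j=1}^n$ be the $n\times n$ anti-tridiagonal operator matrix acting on $\bigoplus_{j=1}^n\mathcal{H}$ with $P_{ij}=T$ if $i+j=n+1$, $P_{ij}=S$ if $|i+j-(n+1)|=1$, and $P_{ij}=O$ otherwise. Then $$\max_{1\le k\le n} w_q\left((-1)^{k+1}\left[T+\left(2\cos\frac{k\pi}{n+1}\right)S\right]\right)\le w_q(\mathbb{P})\le \frac{q+2\sqrt{1-q^2}}{q}\max_{1\le k\le n} w_q\left((-1)^{k+1}\left[T+\left(2\cos\frac{k\pi}{n+1}\right)S\right]\right).$$
   Context: $\mathcal{B}(\mathcal{K})$ denotes the bounded linear operators on a complex Hilbert space $\mathcal{K}$; $O$ is the zero operator. An $n\times n$ matrix $[S_{ij}]$ with entries in $\mathcal{B}(\mathcal{H})$ acts on $\bigoplus_{j=1}^n\mathcal{H}$ (with the direct-sum inner product) by $(x_1,\dots,x_n)\mapsto(\sum_j S_{1j}x_j,\dots,\sum_j S_{nj}x_j)$. For $A\in\mathcal{B}(\mathcal{K})$ and a scalar $q$ with $|q|\le 1$, the $q$-numerical range is $W_q(A)=\{\langle Ax,y\rangle: x,y\in\mathcal{K},\ \|x\|=\|y\|=1,\ \langle x,y\rangle=q\}$ and the $q$-numerical radius is $w_q(A)=\sup\{|z|: z\in W_q(A)\}$. In the degenerate case $\dim\mathcal{K}=1$, where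 $A$ is a scalar $c$ and $W_q(A)$ is empty for $0<q<1$, the convention is $w_q(A)=q|c|$. *)

(* Defs.v *)
From HB Require Import structures.
From mathcomp Require Import all_boot all_order all_algebra.
From mathcomp Require Import complex.
From mathcomp Require Import all_classical all_reals all_analysis.
Import Order.TTheory GRing.Theory Num.Theory.
Import numFieldNormedType.Exports.

Set Implicit Arguments.
Unset Strict Implicit.
Unset Printing Implicit Defensive.

Local Open Scope classical_set_scope.
Local Open Scope complex_scope.
Local Open Scope ring_scope.

(* Cauchy-Schwarz and the triangle inequality are proved in sesquilinear.v only
   for forms on a (finite-dimensional) vectType.                              *)
Section DotTheory.
Variables (C : numClosedFieldType) (U : lmodType C) (f : {dot U for @Num.conj C}).

Lemma dot_CauchySchwarz u v : `|f u v| ^+ 2 <= f u u * f v v.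
Proof.
have [->|v0] := eqVneq v 0.
  by rewrite !linear0r normr0 expr0n.
have fv0 : 0 < f v v by rewrite dnorm_gt0.
pose a := f u v / f v v; pose w := u - a *: v.
have wv : f w v = 0.
  by rewrite /w linearBl/= linearZl_LR/= /a divfK ?gt_eqF// subrr.
have fuv : f u v = a * f v v by rewrite /a divfK ?gt_eqF.
have fuu : f u u = f w w + `|a| ^+ 2 * f v v.
  have -> : u = w + a *: v by rewrite /w subrK.
  clearbody w.
  have wav : f w (a *: v) = 0 by rewrite linearZr_LR/= wv mulr0.
  by rewrite dnormD/= wav conjC0 !addr0 dnormZ.
rewrite fuv fuu normrM (ger0_norm (ltW fv0)) exprMn mulrDl.
by rewrite [f v v ^+ 2]expr2 mulrA lerDr mulr_ge0// ?dnorm_ge0// ltW.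
Qed.

Lemma sqrt_dnormD u v :
  sqrtC (f (u + v) (u + v)) <= sqrtC (f u u) + sqrtC (f v v).
Proof.
rewrite -ler_sqr ?nnegrE ?addr_ge0 ?sqrt_dnorm_ge0// sqrrD !sqrtCK dnormD.
rewrite [leRHS]addrAC lerD2l.
have -> : f u v + (f u v)^* = 'Re (f u v) *+ 2.
  by rewrite -mulr_natr ReE divfK ?pnatr_eq0.
rewrite ler_pMn2r// (le_trans (leif_Re_Creal _))//.
rewrite -ler_sqr ?nnegrE ?mulr_ge0 ?sqrt_dnorm_ge0// exprMn !sqrtCK.
exact: dot_CauchySchwarz.
Qed.

End DotTheory.

(* The inner product is linear in its first argument and conjugate-linear in the
   second one.                                                                *)
HB.mixin Record NormedModule_isHilbert (R : realType) H
    & CompleteNormedModule R[i] H := {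
  hdot : {dot H for (@Num.conj R[i])} ;
  sqr_norm_hdot : forall x : H, `|x| ^+ 2 = hdot x x
}.

#[short(type="hilbertType")]
HB.structure Definition Hilbert (R : realType) :=
  {H of CompleteNormedModule R[i] H & NormedModule_isHilbert R H}.

(* The direct sum carries the norm of its inner product. An alias keeps it apart
   from {ffun 'I_n -> H}.                                                     *)
Definition dsum (n : nat) (H : Type) : Type := {ffun 'I_n -> H}.

Section DirectSum.
Variables (R : realType) (n : nat) (H : hilbertType R).

HB.instance Definition _ := GRing.Lmodule.copy (dsum n H) {ffun 'I_n -> H}.

Definition dsum_dot (x y : dsum n H) : R[i] := \sum_(i < n) hdot (x i) (y i).

Let dsum_dot_bilinear :
  bilinear_for *%R (@Num.conj R[i] \; *%R) dsum_dot.
Proof.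
split=> [y a x x'|x a y y'] /=; rewrite /dsum_dot mulr_sumr -big_split/=.
  by apply: eq_bigr => i _; rewrite !ffunE linearDl/= linearZl_LR.
by apply: eq_bigr => i _; rewrite !ffunE linearDr/= linearZr_LR.
Qed.

HB.instance Definition _ := bilinear_isBilinear.Build R[i] (dsum n H) (dsum n H)
  R[i] *%R (@Num.conj R[i] \; *%R) dsum_dot dsum_dot_bilinear.

Let dsum_dot_hermitian x y :
  dsum_dot x y = (-1) ^+ false * Num.conj (dsum_dot y x).
Proof.
rewrite mul1r /dsum_dot rmorph_sum/=; apply: eq_bigr => i _.
by rewrite (hermC (@hdot _ H)) mul1r.
Qed.

HB.instance Definition _ := isHermitianSesquilinear.Build R[i] (dsum n H) false
  (@Num.conj R[i]) dsum_dot dsum_dot_hermitian.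

Let dsum_dot_gt0 x : x != 0 -> 0 < dsum_dot x x.
Proof.
move=> x0; have xge0 i : 0 <= hdot (x i) (x i) by rewrite dnorm_ge0.
rewrite lt_def sumr_ge0// andbT; apply: contra x0 => /eqP.
move=> /psumr_eq0P => /(_ (fun i _ => xge0 i)) xi0; apply/eqP/ffunP => i.
by apply/eqP; rewrite ffunE -(dnorm_eq0 (@hdot _ H)) xi0.
Qed.

HB.instance Definition _ :=
  isDotProduct.Build R[i] (dsum n H) dsum_dot dsum_dot_gt0.

Let dsum_norm (x : dsum n H) : R[i] := sqrtC (dsum_dot x x).

Let dsum_normD x y : dsum_norm (x + y) <= dsum_norm x + dsum_norm y.
Proof. exact: sqrt_dnormD. Qed.

Let dsum_normZ a x : dsum_norm (a *: x) = `|a| * dsum_norm x.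
Proof.
by rewrite /dsum_norm dnormZ rootCMl ?exprn_ge0// sqrCK.
Qed.

Let dsum_norm_eq0 x : dsum_norm x = 0 -> x = 0.
Proof. by move/eqP; rewrite sqrt_dnorm_eq0 => /eqP. Qed.

HB.instance Definition _ := Lmodule_isNormed.Build R[i] (dsum n H)
  dsum_normD dsum_normZ dsum_norm_eq0.

Lemma sqr_norm_dsum (x : dsum n H) : `|x| ^+ 2 = dsum_dot x x.
Proof. exact: sqrtCK. Qed.

Lemma ler_norm_dsum (x : dsum n H) i : `|x i| <= `|x|.
Proof.
rewrite -ler_sqr ?nnegrE// sqr_norm_hdot sqr_norm_dsum /dsum_dot (bigD1 i)//=.
by rewrite lerDl sumr_ge0// => j _; rewrite dnorm_ge0.
Qed.

Lemma norm_dsum_le (x : dsum n H) : `|x| <= \sum_(i < n) `|x i|.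
Proof.
have sum_sqr (s : seq 'I_n) (F : 'I_n -> R[i]) : (forall i, 0 <= F i) ->
    \sum_(i <- s) F i ^+ 2 <= (\sum_(i <- s) F i) ^+ 2.
  move=> F0; elim: s => [|i s IHs]; first by rewrite !big_nil expr0n.
  rewrite !big_cons sqrrD -addrA lerD2l (le_trans IHs)// lerDr.
  by rewrite mulrn_wge0// mulr_ge0// sumr_ge0.
rewrite -ler_sqr ?nnegrE ?sumr_ge0// sqr_norm_dsum /dsum_dot.
under eq_bigr do rewrite -sqr_norm_hdot.
exact: sum_sqr.
Qed.

Let dsum_complete (F : set_system (dsum n H)) :
  ProperFilter F -> cauchy F -> cvg F.
Proof.
move=> FF /cauchy_ballP Fc.
pose G i := (fun x : dsum n H => x i : H) @ F.
have Gcvg i : cvg (G i).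
  apply/cauchy_cvgP/cauchy_ballP => e e0.
  have := Fc e e0; rewrite /cauchy_ball /=.
  move=> [[A B] [/= FA FB] AB].
  exists ((fun x : dsum n H => x i) @` A, (fun x : dsum n H => x i) @` B) => /=.
    by split; [apply: filterS FA|apply: filterS FB] => x Ax; exists x.
  move=> [_ _] /= [[x Ax <-] [y By <-]].
  have := AB (x, y) (conj Ax By); rewrite -!ball_normE /=.
  by apply: le_lt_trans; have := ler_norm_dsum (x - y) i; rewrite !ffunE.
apply/cvg_ex; exists ([ffun i => lim (G i)] : dsum n H).
apply/cvgrPdist_lt => e e0; have d0 : 0 < e / n.+1%:R by rewrite divr_gt0.
have Fd : \forall x \near F, forall i, `|lim (G i) - (x : dsum n H) i| < e / n.+1%:R.
  by apply: filter_forall => i; have /cvgrPdist_lt := Gcvg i; apply.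
apply: filterS Fd => x xd; rewrite (le_lt_trans (norm_dsum_le _))//.
apply: (@le_lt_trans _ _ (\sum_(i < n) (e / n.+1%:R))); last first.
  rewrite sumr_const card_ord -[ltLHS]mulr_natr mulrAC -mulrA gtr_pMr//.
  by rewrite ltr_pdivrMr// mul1r ltr_nat.
apply: ler_sum => i _; rewrite !ffunE; exact/ltW/xd.
Qed.

HB.instance Definition _ := Uniform_isComplete.Build (dsum n H) dsum_complete.

HB.instance Definition _ :=
  NormedModule_isHilbert.Build R (dsum n H) sqr_norm_dsum.

End DirectSum.

HB.mixin Record isBoundedOperator (R : realType) (U V : normedModType R[i])
    (f : U -> V) := {
  bounded_operator : exists M : R, forall x : U, `|f x| <= M%:C * `|x|
}.

#[short(type="boundedOperator")]
HB.structure Definition BoundedOperator (R : realType) (U V : normedModType R[i]) :=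
  {f of @GRing.Linear R[i] U V *:%R f & isBoundedOperator R U V f}.

Notation "''B' ( H )" := (boundedOperator H H) (format "''B' ( H )") : type_scope.

Section OperatorAlgebra.
Variables (R : realType) (U V : normedModType R[i]).
Variables (f g : boundedOperator U V) (c : R[i]).

Let null_bounded : exists M : R, forall x : U, `|(\0 : U -> V) x| <= M%:C * `|x|.
Proof. by exists 0 => x; rewrite normr0 mul0r. Qed.
HB.instance Definition _ := isBoundedOperator.Build R U V \0 null_bounded.

Let add_bounded : exists M : R, forall x, `|(f \+ g) x| <= M%:C * `|x|.
Proof.
have [M fM] := @bounded_operator _ _ _ f.
have [N gN] := @bounded_operator _ _ _ g.
exists (M + N) => x /=.
by rewrite rmorphD/= mulrDl (le_trans (ler_normD _ _))// lerD.
Qed.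
HB.instance Definition _ := isBoundedOperator.Build R U V (f \+ g) add_bounded.

Let scale_bounded : exists M : R, forall x, `|(c \*: f) x| <= M%:C * `|x|.
Proof.
have [M fM] := @bounded_operator _ _ _ f.
exists (complex.Re `|c| * M) => x /=.
have ce : (complex.Re `|c|)%:C = `|c| by rewrite RRe_real ?normr_real.
have -> : (complex.Re `|c| * M)%:C = `|c| * M%:C by rewrite -{2}ce -rmorphM.
by rewrite normrZ -mulrA ler_wpM2l.
Qed.
HB.instance Definition _ := isBoundedOperator.Build R U V (c \*: f) scale_bounded.

End OperatorAlgebra.

Section BlockOperator.
Variables (R : realType) (n : nat) (H : hilbertType R).
Variable A : 'I_n -> 'I_n -> 'B(H).

Definition block_op (x : dsum n H) : dsum n H := [ffun i => \sum_(j < n) A i j (x j)].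

Let block_op_linear : linear block_op.
Proof.
move=> a x y; apply/ffunP => i; rewrite !ffunE scaler_sumr -big_split/=.
by apply: eq_bigr => j _; rewrite !ffunE linearP.
Qed.

HB.instance Definition _ :=
  GRing.isLinear.Build R[i] (dsum n H) (dsum n H) *:%R block_op block_op_linear.

Let block_op_bounded :
  exists M : R, forall x, `|block_op x| <= M%:C * `|x|.
Proof.
have /choice[M AM] : forall ij : 'I_n * 'I_n, exists M : R, 0 <= M /\
    forall x, `|A ij.1 ij.2 x| <= M%:C * `|x|.
  move=> [i j]; have [M AM] := @bounded_operator _ _ _ (A i j).
  exists `|M|; split=> // x; rewrite (le_trans (AM x))// ler_wpM2r//.
  by rewrite lecR ler_norm.
exists (\sum_(i < n) \sum_(j < n) M (i, j)) => x.
rewrite (le_trans (norm_dsum_le _))// rmorph_sum mulr_suml ler_sum// => i _.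
rewrite ffunE (le_trans (ler_norm_sum _ _ _))// rmorph_sum mulr_suml.
apply: ler_sum => j _; have [M0 AMij] := AM (i, j).
rewrite (le_trans (AMij _))// ler_wpM2l ?ler_norm_dsum//.
by rewrite lecR.
Qed.

HB.instance Definition _ :=
  isBoundedOperator.Build R (dsum n H) (dsum n H) block_op block_op_bounded.

End BlockOperator.

Section QNumericalRadius.
Variables (R : realType) (H : hilbertType R).

Definition q_numerical_range (q : R[i]) (A : 'B(H)) : set R[i] :=
  [set z | exists x y : H,
    [/\ `|x| = 1, `|y| = 1, hdot x y = q & z = hdot (A x) y]].

Definition one_dimensional : Prop :=
  exists2 e : H, e != 0 & forall x : H, exists c : R[i], x = c *: e.

(* The scalar c such that A = c *: id; only meaningful in dimension one. *)
Definition scalar_of (A : 'B(H)) : R[i] :=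
  xget 0 [set c : R[i] | forall x, A x = c *: x].

(* The modulus `|z| lives in R[i]; complex.Re brings it back to R. On the zero
   space the range is empty, and sup set0 = 0 gives the value 0. The first
   branch is the convention for dimension one, where the range is also empty. *)
Definition q_numerical_radius (q : R[i]) (A : 'B(H)) : R :=
  if `[< one_dimensional /\ 0 < q < 1 >] then complex.Re (q * `|scalar_of A|)
  else sup [set complex.Re `|z| | z in q_numerical_range q A].

End QNumericalRadius.

(* Ordinals start at 0, hence the successors in the 1-based conditions. *)
Definition anti_tridiagonal (R : realType) (H : hilbertType R) (n : nat)
    (T S : 'B(H)) (i j : 'I_n) : 'B(H) :=
  if (i.+1 + j.+1 == n + 1)%N then T
  else if `|(i.+1 + j.+1)%N%:Z - (n + 1)%N%:Z| == 1 then S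
  else \0.

(* Since q-numerical radii are nonnegative, 0 is a neutral default value for the
   maximum of a nonempty finite family of them.                               *)
Lemma q_numerical_radius_ge0 (R : realType) (H : hilbertType R) (q : R[i])
  (A : 'B(H)) : 0 <= q_numerical_radius q A.
Proof.
rewrite /q_numerical_radius; case: ifPn => [/asboolP[_ /andP[q0 _]]|_].
  by rewrite -lecR RRe_real ?mulr_ge0 ?ger0_real// ?mulr_ge0// ltW.
set E := (X in sup X).
have [Esup|/sup_out -> //] := pselect (has_sup E).
have [[t Et] _] := Esup; apply: le_trans (sup_upper_bound Esup Et).
by case: Et => z _ <-; have := normr_ge0 z; rewrite lecE => /andP[].
Qed.

(* Main.v *)
From HB Require Import structures.
From mathcomp Require Import all_boot all_order all_algebra.
From mathcomp Require Import complex zify ring lra.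
From mathcomp Require Import all_classical all_reals all_analysis.
Require Import Defs.
Import Order.TTheory GRing.Theory Num.Theory.
Import numFieldNormedType.Exports.
Set Implicit Arguments.
Unset Strict Implicit.
Unset Printing Implicit Defensive.

Local Open Scope complex_scope.
Local Open Scope ring_scope.

(** The reversal of coordinates commutes with the tridiagonal Toeplitz matrix
with T on the diagonal and S beside it, and their product is P. So both are
diagonalised by the same scalar vectors, the discrete sine modes
u_k(j) = sin(j k pi / (n+1)): the reversal multiplies u_k by (-1)^(k+1), and
the neighbour sum multiplies it by 2 cos(k pi / (n+1)). After normalisation the
u_k are an orthonormal basis, and P(u_k (x) h) = u_k (x) A_k h, where A_k is the
operator on the k-th branch of the maximum ([block_op_mode_tensor]): P is
unitarily equivalent to the direct sum of the A_k.

Lower bound: h |-> u_k (x) h is an isometry that intertwines A_k and P, hence the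
q-numerical range of A_k lies in that of P
([q_numerical_radius_diagonal_block]).

Upper bound: everything passes through the ordinary numerical radius w, which
on a direct sum is the maximum of the w(A_k)
([numerical_range_block_op]). Two comparisons, valid for any operator A, then
give the constant. First, q w(A) <= w_q(A) ([numerical_range_le_q]): for a unit
vector z orthogonal to x, the vectors q x + s z and q x - s z with s = sqrt(1 - q^2)
are both admissible partners of x, and the average of the two values is
q <A x, x>. Second, w_q(A) <= (q + 2 s) w(A) ([q_numerical_radius_upper]): split
the partner y into q x and a vector of norm s, and bound the second term by
|<A x, z>| <= 2 w(A), a consequence of polarization ([off_diagonal_le]).

In dimension one the q-numerical range is empty for q < 1; the convention
w_q(c) = q |c| makes both comparisons hold there as well, so the final argument
needs no case distinction. *)

(** * Discrete sine modes *)

Section SineModes.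
Variables (R : realType) (n : nat).

Definition mode_angle (k : nat) : R := k%:R * pi / (n + 1)%:R.
Definition mode_sign (k : nat) : R := (-1) ^+ k.+1.

Definition sine_mode (k j : nat) : R := sin (j%:R * mode_angle k).

Definition anti_diag (i j : 'I_n) : R := (i.+1 + j.+1 == n + 1)%N%:R.

Definition near_anti_diag (i j : 'I_n) : R :=
  (`|(i.+1 + j.+1)%N%:Z - (n + 1)%N%:Z| == 1)%:R.

(** The modes vanish at 0 and n+1, the neighbours of the two ends of the index
range; this is why the boundary rows of the matrices below, which have only one
neighbour entry, satisfy the same eigenvalue equation as the inner rows. *)
Lemma sine_mode_end k : sine_mode k n.+1 = 0.
Proof.
rewrite /sine_mode /mode_angle addn1 mulrC divfK ?pnatr_eq0// -[k%:R * pi]add0r mulrC.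
elim: k => [|k IHk]; first by rewrite mulr0 addr0 sin0.
by rewrite -natr1 mulrDr mulr1 addrA sinDpi IHk oppr0.
Qed.

Lemma sine_mode_flip k j : (j <= n.+1)%N ->
  sine_mode k (n.+1 - j) = mode_sign k * sine_mode k j.
Proof.
move=> jn; rewrite /sine_mode natrB// mulrBl.
have -> : n.+1%:R * mode_angle k = k%:R * pi.
  by rewrite /mode_angle addn1 mulrC divfK ?pnatr_eq0.
move: (_ * mode_angle k) => x; rewrite /mode_sign exprS -[_ - x]addrC.
elim: k => [|k IHk]; first by rewrite mul0r addr0 sinN expr0 mulr1 mulN1r.
rewrite -natr1 mulrDl mul1r addrA sinDpi IHk exprS.
by rewrite !mulN1r !mulNr opprK.
Qed.

Lemma sine_mode_step k j : (0 < j)%N ->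
  sine_mode k j.-1 + sine_mode k j.+1 = 2 * cos (mode_angle k) * sine_mode k j.
Proof.
case: j => // j _; rewrite /sine_mode /= -[j.+2]addn1 -[j.+1]addn1 !natrD.
set t := mode_angle k.
set a := j%:R + 1%:R.
have -> : j%:R * t = a * t - t by rewrite /a; ring.
by rewrite [(a + _) * t]mulrDl mul1r sinB sinD; ring.
Qed.

(** Since f vanishes just outside 1..n, row sums may be evaluated without
separating the boundary rows. *)
Lemma sum_at (f : nat -> R) m : f 0 = 0 -> f n.+1 = 0 -> (m <= n.+1)%N ->
  \sum_(j < n) (j.+1 == m)%:R * f j.+1 = f m.
Proof.
move=> f0 fn; case: m => [_|m]; first by rewrite f0 big1// => j _; rewrite mul0r.
rewrite ltnS leq_eqVlt => /orP[/eqP->|mn].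
  rewrite fn big1// => j _; rewrite eqSS.
  by have := ltn_ord j; rewrite ltn_neqAle => /andP[/negPf-> _]; rewrite mul0r.
rewrite (bigD1 (Ordinal mn))//= eqxx mul1r big1 ?addr0// => j /negPf jm.
by rewrite eqSS -[_ == m]/(j == Ordinal mn) jm mul0r.
Qed.

Lemma sine_mode0 k : sine_mode k 0 = 0.
Proof. by rewrite /sine_mode mul0r sin0. Qed.

Lemma anti_diag_sine k (i : 'I_n) :
  \sum_(j < n) anti_diag i j * sine_mode k j.+1 = mode_sign k * sine_mode k i.+1.
Proof.
have ni := ltn_ord i.
rewrite -sine_mode_flip; last by lia.
rewrite -(@sum_at (sine_mode k) _) ?sine_mode0 ?sine_mode_end//; last by lia.
apply: eq_bigr => j _; rewrite /anti_diag; congr (_ * _).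
by congr (_%:R); congr nat_of_bool; apply/eqP/eqP; lia.
Qed.

Lemma near_anti_diag_sine k (i : 'I_n) :
  \sum_(j < n) near_anti_diag i j * sine_mode k j.+1 =
  mode_sign k * (2 * cos (mode_angle k)) * sine_mode k i.+1.
Proof.
have ni := ltn_ord i.
rewrite mulrAC -sine_mode_flip; last by lia.
rewrite mulrC -sine_mode_step; last by lia.
have at_index m : (m <= n.+1)%N ->
    sine_mode k m = \sum_(j < n) (j.+1 == m)%:R * sine_mode k j.+1.
  by move=> ?; rewrite sum_at ?sine_mode0 ?sine_mode_end.
(* The row of index i meets the two columns next to the reversed index; one of
   them may be 0 or n+1, where the mode vanishes. *)
rewrite (at_index (_.-1)) 1?(at_index (_ - _).+1); [|lia|lia].
rewrite -big_split/=; apply: eq_bigr => j _.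
rewrite /near_anti_diag -mulrDl -natrD; congr (_ * _); congr (_%:R).
have nj := ltn_ord j.
by case: eqP => h1; case: eqP => h2; case: eqP => h3; lia.
Qed.

Lemma mode_angle_gt0 k : (0 < k)%N -> 0 < mode_angle k.
Proof. by move=> k0; rewrite divr_gt0 ?mulr_gt0 ?ltr0n ?pi_gt0// addn1. Qed.

Lemma mode_angle_lt_pi k : (k < n.+1)%N -> mode_angle k < pi.
Proof.
move=> kn; rewrite /mode_angle addn1 ltr_pdivrMr ?ltr0n// mulrC.
by rewrite ltr_pM2l ?pi_gt0// ltr_nat.
Qed.

Lemma cos_mode_angle_inj (k l : 'I_n) :
  cos (mode_angle k.+1) = cos (mode_angle l.+1) -> k = l.
Proof.
have mode_in (m : 'I_n) : mode_angle m.+1 \in `[0, pi].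
  by rewrite in_itv/= !ltW ?mode_angle_gt0 ?mode_angle_lt_pi// ltnS.
move/(cos_inj (mode_in k) (mode_in l)).
rewrite /mode_angle => /(mulIf _) h; apply/val_inj.
have /(mulIf _) : k.+1%:R * pi = l.+1%:R * pi :> R.
  by apply: h; rewrite invr_eq0 pnatr_eq0 addn1.
by move=> /(_ (lt0r_neq0 (pi_gt0 R))) /eqP; rewrite eqr_nat => /eqP[].
Qed.

Definition sine_dot (k l : 'I_n) : R :=
  \sum_(j < n) sine_mode k.+1 j.+1 * sine_mode l.+1 j.+1.

Lemma sine_dot_gt0 k : 0 < sine_dot k k.
Proof.
have kn := ltn_ord k; have n0 : (0 < n)%N by lia.
rewrite /sine_dot (bigD1 (Ordinal n0))//= ltr_wpDr//.
  by rewrite sumr_ge0// => j _; rewrite -expr2 sqr_ge0.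
have s0 : 0 < sine_mode k.+1 1.
  by rewrite /sine_mode mul1r sin_gt0_pi// mode_angle_gt0//= mode_angle_lt_pi.
exact: mulr_gt0.
Qed.

(** Orthogonality of the modes comes from this classical fact, with no
evaluation of trigonometric sums. *)
Lemma symmetric_eigen_orthogonal (A : 'I_n -> 'I_n -> R) (u v : 'I_n -> R) a b :
  (forall i j, A i j = A j i) ->
  (forall i, \sum_(j < n) A i j * u j = a * u i) ->
  (forall i, \sum_(j < n) A i j * v j = b * v i) ->
  a != b -> \sum_(j < n) u j * v j = 0.
Proof.
move=> Asym Au Av ab.
suff : (a - b) * \sum_(j < n) u j * v j = 0.
  by move/eqP; rewrite mulf_eq0 subr_eq0 (negPf ab) => /eqP.
apply/eqP; rewrite mulrBl subr_eq0 !mulr_sumr; apply/eqP.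
transitivity (\sum_(i < n) \sum_(j < n) A i j * u j * v i).
  by apply: eq_bigr => i _; rewrite mulrA -Au mulr_suml.
rewrite exchange_big/=; apply: eq_bigr => j _.
rewrite mulrCA -Av mulr_sumr; apply: eq_bigr => i _.
by rewrite Asym mulrC mulrA mulrC [v i * _]mulrC mulrA.
Qed.

(** Modes of opposite sign are separated by the reversal. Modes of equal sign
have distinct cosines, since the angles lie in [0, pi] where cos is injective,
so they are separated by the neighbour matrix. *)
Lemma sine_dot_eq0 (k l : 'I_n) : k != l -> sine_dot k l = 0.
Proof.
move=> kl.
have [sign_eq|] := eqVneq (mode_sign k.+1) (mode_sign l.+1); last first.
  apply: (@symmetric_eigen_orthogonal anti_diag) => *; try exact: anti_diag_sine.
  by rewrite /anti_diag addnC.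
apply: (@symmetric_eigen_orthogonal near_anti_diag); try exact: near_anti_diag_sine.
  by move=> i j; rewrite /near_anti_diag addnC.
apply: contra kl => /eqP; rewrite sign_eq => /mulfI.
rewrite /mode_sign signr_eq0 => /(_ isT) /mulfI.
by rewrite pnatr_eq0 => /(_ isT) /cos_mode_angle_inj->.
Qed.

(** Dividing by the actual norm of each mode spares the computation of its value
sqrt((n+1)/2); positivity of the norm is enough. *)
Definition sine_matrix : 'M[R]_n :=
  \matrix_(k, j) (sine_mode k.+1 j.+1 / Num.sqrt (sine_dot k k)).

Lemma sine_matrix_orthonormal (k l : 'I_n) :
  \sum_(j < n) sine_matrix k j * sine_matrix l j = (k == l)%:R.
Proof.
under eq_bigr do rewrite !mxE mulrACA.
rewrite -mulr_suml -/(sine_dot k l).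
have [<-|kl] := eqVneq k l; last by rewrite sine_dot_eq0// mul0r.
have k0 := sine_dot_gt0 k.
by rewrite -invfM -expr2 sqr_sqrtr 1?ltW// divff ?gt_eqF.
Qed.

(** A square matrix with orthonormal rows has orthonormal columns. *)
Lemma sine_matrix_complete (i j : 'I_n) :
  \sum_(k < n) sine_matrix k i * sine_matrix k j = (i == j)%:R.
Proof.
have /mulmx1C : sine_matrix *m sine_matrix^T = 1%:M.
  apply/matrixP => k l; rewrite !mxE -sine_matrix_orthonormal.
  by apply: eq_bigr => m _; rewrite [sine_matrix^T _ _]mxE.
move=> /matrixP/(_ i j); rewrite !mxE => <-.
by apply: eq_bigr => m _; rewrite [sine_matrix^T _ _]mxE.
Qed.

Lemma anti_diag_sine_matrix (k i : 'I_n) :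
  \sum_(j < n) sine_matrix k j * anti_diag i j = mode_sign k.+1 * sine_matrix k i.
Proof.
under eq_bigr do rewrite mulrC mxE mulrA.
by rewrite -mulr_suml anti_diag_sine mxE mulrA.
Qed.

Lemma near_anti_diag_sine_matrix (k i : 'I_n) :
  \sum_(j < n) sine_matrix k j * near_anti_diag i j =
  mode_sign k.+1 * (2 * cos (mode_angle k.+1)) * sine_matrix k i.
Proof.
under eq_bigr do rewrite mulrC mxE mulrA.
by rewrite -mulr_suml near_anti_diag_sine mxE [RHS]mulrA.
Qed.

End SineModes.

(** * Comparison of the q-numerical and the numerical radius *)

Section QNumericalRadiusBounds.
Variables (R : realType) (H : hilbertType R).
Implicit Types (A : 'B(H)) (q m r : R) (x y z h : H).

Lemma Re_normC (z : R[i]) : (complex.Re `|z|)%:C = `|z|.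
Proof. by rewrite RRe_real ?normr_real. Qed.

Lemma Re_mul_normC r (z : R[i]) : (complex.Re (r%:C * `|z|))%:C = r%:C * `|z|.
Proof. by rewrite -Re_normC -rmorphM. Qed.

Lemma Re_norm_le (z : R[i]) r : (complex.Re `|z| <= r) = (`|z| <= r%:C).
Proof. by rewrite -lecR Re_normC. Qed.

Lemma conjC_real (a : R) : (a%:C)^* = a%:C :> R[i].
Proof. exact: conjc_real. Qed.

Lemma hdotC x y : hdot x y = (hdot y x)^*.
Proof. by rewrite (hermC (@hdot _ H)) mul1r. Qed.

Lemma hdotDl x y z : hdot (x + y) z = hdot x z + hdot y z.
Proof. exact: linearDl. Qed.

Lemma hdotDr x y z : hdot x (y + z) = hdot x y + hdot x z.
Proof. exact: linearDr. Qed.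

Lemma hdotBl x y z : hdot (x - y) z = hdot x z - hdot y z.
Proof. exact: linearBl. Qed.

Lemma hdotBr x y z : hdot x (y - z) = hdot x y - hdot x z.
Proof. exact: linearBr. Qed.

Lemma hdotZl a x y : hdot (a *: x) y = a * hdot x y.
Proof. exact: linearZl_LR. Qed.

Lemma hdotZr a x y : hdot x (a *: y) = a^* * hdot x y.
Proof. exact: linearZr_LR. Qed.

Lemma hdot_suml (I : Type) (r : seq I) h (F : I -> H) :
  hdot (\sum_(i <- r) F i) h = \sum_(i <- r) hdot (F i) h.
Proof. exact: linear_sumlz. Qed.

Lemma hdot_sumr (I : Type) (r : seq I) h (F : I -> H) :
  hdot h (\sum_(i <- r) F i) = \sum_(i <- r) hdot h (F i).
Proof. exact: linear_sumr. Qed.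

Lemma hdot_CauchySchwarz x y : `|hdot x y| <= `|x| * `|y|.
Proof.
rewrite -ler_sqr ?nnegrE ?mulr_ge0// exprMn !sqr_norm_hdot.
exact: dot_CauchySchwarz.
Qed.

Lemma norm1_hdot x : (`|x| = 1) <-> (hdot x x = 1).
Proof.
rewrite -sqr_norm_hdot; split=> [->|/eqP]; first by rewrite expr1n.
rewrite sqrf_eq1 => /orP[/eqP//|/eqP x1].
by have := normr_ge0 x; rewrite x1 oppr_ge0 ler10.
Qed.

(** On a line, Cauchy-Schwarz is an equality, so unit vectors have an inner
product of modulus 1. *)
Lemma one_dimensional_no_pair q x y : one_dimensional H -> 0 < q < 1 ->
  `|x| = 1 -> `|y| = 1 -> hdot x y = q%:C -> False.
Proof.
move=> [e e0 span] /andP[q0 q1] x1 y1 xy.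
have [a xa] := span x; have [b yb] := span y.
have : `|hdot x y| = `|x| * `|y|.
  rewrite xa yb hdotZl hdotZr !normrM !normrZ norm_conjC.
  by rewrite -sqr_norm_hdot normrX normr_id expr2; ring.
rewrite x1 y1 xy mul1r ger0_norm ?ler0c 1?ltW// => -[qE].
by rewrite qE ltxx in q1.
Qed.

(** The supremum takes an arbitrary default value on sets that are empty or
unbounded; boundedness comes from that of A, by Cauchy-Schwarz. *)
Lemma q_numerical_range_has_sup q A x y :
  `|x| = 1 -> `|y| = 1 -> hdot x y = q%:C ->
  has_sup [set complex.Re `|z| | z in q_numerical_range q%:C A]%classic.
Proof.
move=> x1 y1 xy; split.
  by exists (complex.Re `|hdot (A x) y|), (hdot (A x) y) => //; exists x, y.
have [M AM] := @bounded_operator _ _ _ A.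
exists M => _ [_ [u [v [u1 v1 _ ->]]] <-]; rewrite Re_norm_le.
rewrite (le_trans (hdot_CauchySchwarz _ _))// v1 mulr1.
by rewrite (le_trans (AM _))// u1 mulr1.
Qed.

Lemma le_q_numerical_radius q A x y : 0 < q <= 1 ->
  `|x| = 1 -> `|y| = 1 -> hdot x y = q%:C ->
  `|hdot (A x) y| <= (q_numerical_radius q%:C A)%:C.
Proof.
move=> q01 x1 y1 xy; rewrite /q_numerical_radius; case: ifPn => [/asboolP[Hone]|_].
  rewrite !ltcR => q1.
  by have := one_dimensional_no_pair Hone q1 x1 y1 xy.
rewrite -Re_norm_le; apply: sup_upper_bound.
  exact: q_numerical_range_has_sup x1 y1 xy.
by exists (hdot (A x) y) => //; exists x, y.
Qed.

Lemma scalar_ofP A : one_dimensional H -> forall x, A x = scalar_of A *: x.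
Proof.
move=> [e e0 span]; rewrite /scalar_of; case: xgetP => [c _ //|noscal].
have [c Ae] := span (A e); exfalso; apply: (noscal c) => x.
by have [a ->] := span x; rewrite linearZ/= Ae !scalerA mulrC.
Qed.

(** An upper bound of the q-numerical radius in all dimensions. The bound on
q <A x, x> serves the one-dimensional convention, where this is the value
itself; the nonnegativity of r serves the empty range of the zero space. *)
Lemma q_numerical_radius_le q A r : 0 < q <= 1 -> 0 <= r ->
  (forall x y, `|x| = 1 -> `|y| = 1 -> hdot x y = q%:C ->
     `|hdot (A x) y| <= r%:C) ->
  (forall x, `|x| = 1 -> q%:C * `|hdot (A x) x| <= r%:C) ->
  q_numerical_radius q%:C A <= r.
Proof.
move=> /andP[q0 q1] r0 rng eig; rewrite /q_numerical_radius.
case: ifPn => [/asboolP[Hone _]|_].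
  have [e e0 _] := Hone.
  have eN : `|e| != 0 by rewrite normr_eq0.
  have u1 : `| `|e|^-1 *: e| = 1 by rewrite normrZ normfV normr_id mulVf.
  rewrite -lecR Re_mul_normC; have := eig _ u1; rewrite (scalar_ofP A Hone) hdotZl.
  by rewrite ((norm1_hdot _).1 u1) mulr1.
set W := (X in sup X).
have [[w rw]|W0] := pselect (W !=set0)%classic.
  apply: ge_sup; first by exists w.
  by move=> _ [_ [x [y [x1 y1 xy ->]]] <-]; rewrite Re_norm_le; exact: rng.
by rewrite sup_out// => -[].
Qed.

Lemma exists_orthogonal_unit x : `|x| = 1 -> ~ one_dimensional H ->
  exists2 z, `|z| = 1 & hdot x z = 0.
Proof.
move=> x1 Hnot.
have [y ny] : exists y, forall c : R[i], y != c *: x.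
  apply: contrapT => none; apply: Hnot; exists x.
    by rewrite -normr_eq0 x1 oner_eq0.
  move=> y; apply: contrapT => yx; apply: none; exists y => c.
  by apply/eqP => yc; apply: yx; exists c.
pose w := y - hdot y x *: x.
have w0 : `|w| != 0 by rewrite normr_eq0 subr_eq0 ny.
exists (`|w|^-1 *: w); first by rewrite normrZ normfV normr_id mulVf.
rewrite hdotZr hdotBr hdotZr ((norm1_hdot x).1 x1) mulr1.
by rewrite -hdotC subrr mulr0.
Qed.

(** The inequality q w(A) <= w_q(A): average the two values obtained from the
partners q x + s z and q x - s z of x, where z is orthogonal to x. *)
Lemma numerical_range_le_q A q x : 0 < q <= 1 -> `|x| = 1 ->
  q%:C * `|hdot (A x) x| <= (q_numerical_radius q%:C A)%:C.
Proof.
move=> q01 x1; have /andP[q0 q1] := q01.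
have xx := (norm1_hdot x).1 x1.
have [q1E|q1E] := eqVneq q 1.
  rewrite q1E mul1r; apply: le_q_numerical_radius => //.
  by rewrite ltr01 lexx.
have qlt1 : q < 1 by rewrite lt_neqAle q1E.
have [Hone|Hnot] := pselect (one_dimensional H).
  rewrite /q_numerical_radius ifT; last by apply/asboolP; split=> //; rewrite !ltcR q0.
  by rewrite Re_mul_normC {1}(scalar_ofP A Hone) hdotZl xx mulr1.
have [z z1 xz] := exists_orthogonal_unit x1 Hnot.
have zx : hdot z x = 0 by rewrite hdotC xz conjC0.
have zz := (norm1_hdot z).1 z1.
pose s := Num.sqrt (1 - q ^+ 2).
have s2 : s ^+ 2 = 1 - q ^+ 2 by rewrite sqr_sqrtr// subr_ge0 expr_le1// ltW.
have bound (t : R) : t ^+ 2 = 1 - q ^+ 2 ->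
    `|q%:C * hdot (A x) x + t%:C * hdot (A x) z| <= (q_numerical_radius q%:C A)%:C.
  move=> t2.
  have -> : q%:C * hdot (A x) x + t%:C * hdot (A x) z =
            hdot (A x) (q%:C *: x + t%:C *: z).
    by rewrite hdotDr !hdotZr !conjC_real.
  apply: le_q_numerical_radius => //.
    apply/norm1_hdot; rewrite hdotDl !hdotDr !hdotZl !hdotZr.
    rewrite !conjC_real xx zz xz zx !mulr0 !addr0 add0r !mulr1 -!rmorphM -rmorphD/=.
    by rewrite -!expr2 t2 addrC subrK.
  by rewrite hdotDr !hdotZr !conjC_real xx xz mulr1 mulr0 addr0.
have := lerD (bound s s2) (bound (- s) (etrans (sqrrN s) s2)).
rewrite rmorphN/= mulNr => /(le_trans (ler_normD _ _)).
rewrite addrACA subrr addr0 -!mulr2n normrMn ler_pMn2r// normrM.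
by rewrite ger0_norm// ler0c ltW.
Qed.

Lemma numerical_range_le_qZ A q x : 0 < q <= 1 ->
  q%:C * `|hdot (A x) x| <= (q_numerical_radius q%:C A)%:C * `|x| ^+ 2.
Proof.
move=> q01; have [->|x0] := eqVneq x 0.
  by rewrite linear0r !normr0 expr0n !mulr0.
have xN : `|x| != 0 by rewrite normr_eq0.
have u1 : `| `|x|^-1 *: x| = 1 by rewrite normrZ normfV normr_id mulVf.
have := numerical_range_le_q A q01 u1.
rewrite [A (_ *: _)]linearZ hdotZl hdotZr !normrM norm_conjC normfV normr_id.
rewrite mulrA -expr2 exprVn [_^-1 * _]mulrC mulrA.
by rewrite ler_pdivrMr// exprn_gt0// normr_gt0.
Qed.

Lemma form_polarization A x z a :
  hdot (A (x + a *: z)) (x + a *: z) - hdot (A (x - a *: z)) (x - a *: z) =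
  (a^* * hdot (A x) z + a * hdot (A z) x) *+ 2.
Proof.
have -> : A (x + a *: z) = A x + a *: A z by rewrite linearD linearZ.
have -> : A (x - a *: z) = A x - a *: A z by rewrite linearB linearZ.
by rewrite !(hdotBl, hdotDl) !(hdotBr, hdotDr) !hdotZl !hdotZr; ring.
Qed.

Lemma parallelogram x y : `|x + y| ^+ 2 + `|x - y| ^+ 2 = (`|x| ^+ 2 + `|y| ^+ 2) *+ 2.
Proof.
rewrite !sqr_norm_hdot hdotBl hdotDl !hdotBr !hdotDr; ring.
Qed.

(** With Q(h) = <A h, h> and D(a) = Q(x + a z) - Q(x - a z), one has
4 <A x, z> = D(1) + i D(i), and the parallelogram law gives |D(a)| <= 4 m
for |a| = 1. *)
Lemma off_diagonal_le A m : (forall h, `|hdot (A h) h| <= m%:C * `|h| ^+ 2) ->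
  forall x z, `|x| = 1 -> `|z| = 1 -> `|hdot (A x) z| <= (2 * m)%:C.
Proof.
move=> Am x z x1 z1.
pose D (a : R[i]) := (a^* * hdot (A x) z + a * hdot (A z) x) *+ 2.
have DM (a : R[i]) : `|a| = 1 -> `|D a| <= (4 * m)%:C.
  move=> a1; rewrite /D -form_polarization (le_trans (ler_normB _ _))//.
  rewrite (le_trans (lerD (Am _) (Am _)))// -mulrDr parallelogram.
  rewrite normrZ a1 x1 z1 mulr1 expr1n rmorphM/= mulrC.
  by rewrite (_ : (1 + 1) *+ 2 = 4%:C)// rmorph_nat -natr1; ring.
have := lerD (DM 1 (normr1 _)) (DM 'i (normCi _)).
have <- : `|'i * D 'i| = `|D 'i| by rewrite normrM normCi mul1r.
move/(le_trans (ler_normD _ _)).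
have -> : D 1 + 'i * D 'i = hdot (A x) z *+ 4.
  have i2 : 'i * 'i = -1 :> R[i] by rewrite -expr2 sqrCi.
  rewrite /D conjCi conjC1.
  transitivity ((hdot (A x) z + hdot (A z) x) *+ 2 +
     ('i * 'i) * (- hdot (A x) z + hdot (A z) x) *+ 2); first by ring.
  by rewrite i2; ring.
rewrite normrMn -rmorphD/=.
rewrite (_ : (4 * m + 4 * m)%:C = (2 * m)%:C *+ 4).
  by rewrite ler_pMn2r.
by rewrite -rmorphMn/=; congr _%:C; ring.
Qed.

(** Write y = q x + w with w orthogonal to x and of norm sqrt(1 - q^2); the first
part contributes at most q m, the second at most 2 m times the norm of w. *)
Lemma q_numerical_radius_upper A q m : 0 < q <= 1 -> 0 <= m ->
  (forall h, `|hdot (A h) h| <= m%:C * `|h| ^+ 2) ->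
  q_numerical_radius q%:C A <= (q + 2 * Num.sqrt (1 - q ^+ 2)) * m.
Proof.
move=> q01 m0 Am; have /andP[q0 q1] := q01.
pose s := Num.sqrt (1 - q ^+ 2).
have s0 : 0 <= s by exact: sqrtr_ge0.
have s2 : s ^+ 2 = 1 - q ^+ 2 by rewrite sqr_sqrtr// subr_ge0 expr_le1// ltW.
have qC : 0 <= q%:C by rewrite ler0c ltW.
have Adiag x : `|x| = 1 -> `|hdot (A x) x| <= m%:C.
  by move=> x1; rewrite (le_trans (Am x))// x1 expr1n mulr1.
apply: q_numerical_radius_le => //.
- by rewrite mulr_ge0// addr_ge0 ?mulr_ge0// ltW.
- move=> x y x1 y1 xy.
  have xx := (norm1_hdot x).1 x1.
  pose w := y - q%:C *: x.
  have yx : hdot y x = q%:C by rewrite hdotC xy conjC_real.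
  have ww : `|w| = s%:C.
    apply/eqP; rewrite -(eqrXn2 (n := 2))// ?ler0c//; apply/eqP.
    rewrite sqr_norm_hdot hdotBl !hdotBr !hdotZl !hdotZr.
    rewrite xx xy yx ((norm1_hdot y).1 y1) conjC_real -rmorphXn/= s2.
    rewrite rmorphB rmorphXn/= rmorph1.
    by ring.
  have -> : hdot (A x) y = q%:C * hdot (A x) x + hdot (A x) w.
    by rewrite /w hdotBr hdotZr conjC_real addrC subrK.
  have Aw : `|hdot (A x) w| <= s%:C * (2 * m)%:C.
    have [w0|w0] := eqVneq w 0.
      by rewrite w0 linear0r normr0 -rmorphM ler0c !mulr_ge0.
    have wN : `|w| != 0 by rewrite normr_eq0.
    have u1 : `| `|w|^-1 *: w| = 1 by rewrite normrZ normfV normr_id mulVf.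
    have := off_diagonal_le Am x1 u1.
    rewrite hdotZr normrM norm_conjC normfV normr_id mulrC.
    by rewrite ler_pdivrMr ?normr_gt0// ww mulrC.
  rewrite (le_trans (ler_normD _ _))// mulrDl rmorphD/= lerD//.
    by rewrite normrM ger0_norm// rmorphM ler_wpM2l// Adiag.
  by rewrite (le_trans Aw)// -rmorphM -/s lecR; lra.
- move=> x x1; rewrite mulrDl rmorphD/=.
  rewrite (@le_trans _ _ (q * m)%:C)//.
    by rewrite rmorphM ler_wpM2l// Adiag.
  by rewrite lerDl ler0c !mulr_ge0.
Qed.

End QNumericalRadiusBounds.

(** * Diagonalisation of the anti-tridiagonal block operator *)

Section AntiTridiagonalDiagonalisation.
Variables (R : realType) (H : hilbertType R) (n : nat) (T S : 'B(H)).
Implicit Types (h g : H) (x : dsum n H) (k i j : 'I_n) (m : R).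

Local Notation P := (block_op (@anti_tridiagonal R H n T S)).
Local Notation U := (@sine_matrix R n).

Definition diagonal_block (k : nat) : 'B(H) :=
  (-1) ^+ k.+1 \*: (T \+ (2 * cos (k%:R * pi / (n + 1)%:R))%:C \*: S).

(** The elementary tensor of the k-th normalised mode with h, in the
identification of the direct sum with R[i]^n (x) H. *)
Definition mode_tensor k h : dsum n H := [ffun j => (U k j)%:C *: h].

Definition mode_coord k x : H := \sum_(j < n) (U k j)%:C *: x j.

Lemma hdot_dsumE (x y : dsum n H) : hdot x y = \sum_(i < n) hdot (x i) (y i).
Proof. by []. Qed.

Lemma anti_tridiagonalE i j h :
  anti_tridiagonal T S i j h =
  (anti_diag R i j)%:C *: T h + (near_anti_diag R i j)%:C *: S h.
Proof.
rewrite /anti_tridiagonal /anti_diag /near_anti_diag.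
case: (eqVneq (i.+1 + j.+1)%N (n + 1)%N) => [->|_].
  by rewrite subrr normr0 /= scale1r scale0r addr0.
by case: eqP => _ /=; rewrite scale0r add0r ?scale1r ?scale0r.
Qed.

(** [mode_coord k] is the adjoint of the isometry [mode_tensor k]. *)
Lemma hdot_mode_tensor k h x : hdot (mode_tensor k h) x = hdot h (mode_coord k x).
Proof.
rewrite hdot_dsumE /mode_coord hdot_sumr; apply: eq_bigr => j _.
by rewrite ffunE hdotZl hdotZr conjC_real.
Qed.

Lemma mode_coord_tensor k h : mode_coord k (mode_tensor k h) = h.
Proof.
rewrite /mode_coord; under eq_bigr do rewrite ffunE scalerA -rmorphM.
by rewrite -scaler_suml -rmorph_sum/= sine_matrix_orthonormal eqxx scale1r.
Qed.

Lemma mode_tensor_isometry k h g : hdot (mode_tensor k h) (mode_tensor k g) = hdot h g.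
Proof. by rewrite hdot_mode_tensor mode_coord_tensor. Qed.

Lemma mode_decomposition x : x = \sum_(k < n) mode_tensor k (mode_coord k x).
Proof.
apply/ffunP => i; rewrite sum_ffunE.
under eq_bigr do rewrite ffunE /mode_coord scaler_sumr.
rewrite exchange_big/=.
under eq_bigr => j _.
  under eq_bigr do rewrite scalerA -rmorphM.
  rewrite -scaler_suml -rmorph_sum/= sine_matrix_complete.
  over.
rewrite (bigD1 i)//= eqxx scale1r big1 ?addr0// => j /negPf ji.
by rewrite eq_sym ji scale0r.
Qed.

Lemma block_op_mode_tensor k h :
  P (mode_tensor k h) = mode_tensor k (diagonal_block k.+1 h).
Proof.
apply/ffunP => i; rewrite !ffunE.
under eq_bigr do rewrite anti_tridiagonalE ffunE !linearZ/= !scalerA -!rmorphM.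
rewrite big_split/= -!scaler_suml -!rmorph_sum/=.
rewrite anti_diag_sine_matrix near_anti_diag_sine_matrix.
rewrite /diagonal_block /= scalerA scalerDr scalerA.
have -> : ((-1) ^+ k.+2 : R[i]) = (mode_sign R k.+1)%:C.
  by rewrite /mode_sign rmorphXn/= rmorphN1.
rewrite -!rmorphM /= /mode_angle; congr (_%:C *: _ + _%:C *: _); ring.
Qed.

Lemma hdot_block_op x :
  hdot (P x) x =
  \sum_(k < n) hdot (diagonal_block k.+1 (mode_coord k x)) (mode_coord k x).
Proof.
rewrite {1}[x]mode_decomposition linear_sum.
rewrite hdot_suml; apply: eq_bigr => k _.
by rewrite -hdot_mode_tensor -block_op_mode_tensor.
Qed.

Lemma sqr_norm_mode_coord x : `|x| ^+ 2 = \sum_(k < n) `|mode_coord k x| ^+ 2.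
Proof.
rewrite sqr_norm_hdot {1}[x]mode_decomposition hdot_suml.
by apply: eq_bigr => k _; rewrite hdot_mode_tensor -sqr_norm_hdot.
Qed.

(** The numerical radius of an orthogonal direct sum is at most the largest one
of its summands, as both <P x, x> and |x|^2 split over the modes. *)
Lemma numerical_range_block_op m :
  (forall k h, `|hdot (diagonal_block k.+1 h) h| <= m%:C * `|h| ^+ 2) ->
  forall x, `|hdot (P x) x| <= m%:C * `|x| ^+ 2.
Proof.
move=> Dm x; rewrite hdot_block_op sqr_norm_mode_coord mulr_sumr.
by rewrite (le_trans (ler_norm_sum _ _ _))// ler_sum.
Qed.

(** The isometry [mode_tensor k] carries admissible pairs for the block to
admissible pairs for P with the same value. When H is a line and n > 1, the block
falls under the one-dimensional convention for q < 1 and P does not; the value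
q |c| is then reached through [numerical_range_le_q] for P. *)
Lemma q_numerical_radius_diagonal_block (q : R) k : 0 < q <= 1 ->
  q_numerical_radius q%:C (diagonal_block k.+1) <= q_numerical_radius q%:C P.
Proof.
move=> q01.
have tensor1 h : `|h| = 1 -> `|mode_tensor k h| = 1.
  by rewrite !norm1_hdot mode_tensor_isometry.
apply: q_numerical_radius_le => // [|h g h1 g1 hg|h h1].
- exact: q_numerical_radius_ge0.
- rewrite -(mode_tensor_isometry k) -block_op_mode_tensor.
  apply: le_q_numerical_radius => //; try exact: tensor1.
  by rewrite mode_tensor_isometry.
- rewrite -(mode_tensor_isometry k) -block_op_mode_tensor.
  exact/numerical_range_le_q/tensor1.
Qed.

End AntiTridiagonalDiagonalisation.

(** * Bounds for the q-numerical radius *)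

Theorem theorem3p4 (R : realType) (H : hilbertType R) (T S : 'B(H)) (q : R)
    (n : nat) :
  0 < q <= 1 -> (0 < n)%N ->
  let M : R := \big[Num.max/0]_(1 <= k < n.+1)
    q_numerical_radius q%:C
      ((-1) ^+ k.+1 \*: (T \+ (2 * cos (k%:R * pi / (n + 1)%:R))%:C \*: S)) in
  M <= q_numerical_radius q%:C (block_op (@anti_tridiagonal R H n T S))
    <= (q + 2 * Num.sqrt (1 - q ^+ 2)) / q * M.
Proof.
move=> q01 _; cbv zeta; set M := (X in X <= _ <= _); have /andP[q0 q1] := q01.
have ME : M =
    \big[Num.max/0]_(k < n) q_numerical_radius q%:C (diagonal_block n T S k.+1).
  by rewrite /M big_add1 big_mkord.
have le_M (k : 'I_n) : q_numerical_radius q%:C (diagonal_block n T S k.+1) <= M.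
  by rewrite ME; apply: (le_bigmax _ (fun k : 'I_n => _) k).
have M0 : 0 <= M.
  by rewrite ME; elim/big_ind: _ => // [a b a0 b0|k _];
    rewrite ?le_max ?a0// q_numerical_radius_ge0.
apply/andP; split.
  rewrite ME; apply: bigmax_le => [|k _]; first exact: q_numerical_radius_ge0.
  exact: q_numerical_radius_diagonal_block.
(* The numerical radius of every block is at most M / q, hence so is that of
   the whole operator. *)
rewrite -mulrA; apply: q_numerical_radius_upper => //.
  by rewrite mulr_ge0// invr_ge0 ltW.
apply: numerical_range_block_op => k h.
rewrite rmorphM fmorphV -mulrA ler_pdivlMl; last by rewrite ltcR.
rewrite (le_trans (numerical_range_le_qZ _ _ q01))//.
by rewrite ler_wpM2r ?exprn_ge0// lecR.
Qed.
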